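(* With $CC_{\mathcal G}(d,2)=\sup_{l\ge 3}CC_l(d,2)$ as defined in the context, $$CC_{\mathcal G}(d,2)\le \tfrac{3}{8}d^2+O(d).$$
   Context: For a group $G$ and an inverse-closed subset $X\subseteq G$ not containing the identity, $C(G,X)$ denotes the undirected Cayley graph with vertex set $G$ in which $g$ is adjacent to $gx$ for each $x\in X$; its degree is $d=|X|$ and its order is $|G|$. A circulant graph is a Cayley graph of a cyclic group. Let $F=GF(p)$ be the Galois field of prime order $p$, with multiplicative group $F^*$ (identity $1$) and additive group $F^+$ (identity $0$). For odd $n\in\mathbb{N}$ consider the group $F^*\times F^+\times\mathbb{Z}_n$ with componentwise operation. For $x\in F^*$, $y\in F^+$, $u,v,w\in\mathbb{Z}_n$ let $a_u(x)=(x,x,u)$, $b_v(x)=(x,0,v)$, $c_w(y)=(1,y,w)$, with inverses $a_u^{-1}(x)=(x^{-1},-x,-u)$, $b_v^{-1}(x)=(x^{-1},0,-v)$, $c_w^{-1}(y)=(1,-y,-w)$. Let $A_u=\{a_u(x),a_u^{-1}(x):x\in F^*\}$, $B_v=\{b_v(x),b_v^{-1}(x):x\in F^*\}$, $C_w^+=\{c_w(y),c_w^{-1}(y):y\in F^+\}$. For any $l\ge 3$ consider different odd values of $n$ and, for each $n$, the corresponding family of cyclic groups $G=F^*\times F^+\times\mathbb{Z}_n$ for any admissible prime $p$, that is, any prime $p$ such that $p$, $p-1$, $n$ are pairwise coprime. Consider inverse-closed generating sets $X$ of $G$ comprised of all possible combinations of the sets $A_u$, $B_v$, $C_w^+$,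 where the only set with subscript $0$ that is used is $C_0^+$, which is included in $X$ if $l$ is odd and not included if $l$ is even, along with a fixed number of other elements of $G$, such that $|X|=lp+\delta$ for some fixed $\delta$, with the condition that the Cayley graph $C(G,X)$ has diameter 2. For any $l$ define $n_l$ to be the largest value of $n$ for which such a Cayley graph $C(G,X)$ exists for all admissible $p$, and define $G_l=F^*\times F^+\times\mathbb{Z}_{n_l}$. The order of $C(G_l,X)$ is $(n_l/l^2)d^2+O(d)$, and this order is denoted $CC_l(d,2)$. Finally $\mathcal G=\{G_l:l\ge 3\}$ and $CC_{\mathcal G}(d,2)=\sup_{l\ge 3}CC_l(d,2)$. *)

(* Defs.v *)
From HB Require Import structures.
From mathcomp Require Import all_boot all_order all_algebra all_fingroup.
From mathcomp Require Import all_classical all_reals all_analysis.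

Set Implicit Arguments.
Unset Strict Implicit.
Unset Printing Implicit Defensive.

Import Order.TTheory GRing.Theory Num.Theory.
Import numFieldNormedType.Exports.

Local Open Scope ring_scope.

Section Graphs.
Variables (T : finType) (e : rel T).

Definition walk (x y : T) (k : nat) : Prop :=
  exists s : seq T, [/\ path e x s, last x s = y & size s = k].

Definition is_distance (x y : T) (k : nat) : Prop :=
  walk x y k /\ (forall j, walk x y j -> (k <= j)%N).

Definition has_diameter (D : nat) : Prop :=
  (forall x y, exists2 k, is_distance x y k & (k <= D)%N) /\
  (exists x y, is_distance x y D).

End Graphs.

Definition cayley (gT : finGroupType) (X : {set gT}) : rel gT :=
  [rel g h | [exists x in X, h == (g * x)%g]].

(* Z_n is 'I_n.-1.+1, the additive group of integers mod n for every n >= 1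
   (whereas 'Z_1 is Z/2Z). The last two factors carry their additive group
   laws. *)
Definition FFZ (p n : nat) : finGroupType :=
  ({unit 'F_p} * 'F_p * 'I_n.-1.+1)%type.

Section ConnectionSets.
Variables p n : nat.
Implicit Types (x : {unit 'F_p}) (y : 'F_p) (u v w : 'I_n.-1.+1).

Definition a_ u x : FFZ p n := (x, val x, u).
Definition b_ v x : FFZ p n := (x, 0, v).
Definition c_ w y : FFZ p n := (1%g, y, w).

Definition A_ u : {set FFZ p n} :=
  [set a_ u x | x : {unit 'F_p}] :|: [set ((a_ u x)^-1)%g | x : {unit 'F_p}].
Definition B_ v : {set FFZ p n} :=
  [set b_ v x | x : {unit 'F_p}] :|: [set ((b_ v x)^-1)%g | x : {unit 'F_p}].
Definition C_ w : {set FFZ p n} :=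
  [set c_ w y | y : 'F_p] :|: [set ((c_ w y)^-1)%g | y : 'F_p].

(* C_ 0 contains the identity of the group, which no connection set of a
   Cayley graph does; it is discarded. *)
Definition base_set (l : nat) (U V W : {set 'I_n.-1.+1}) : {set FFZ p n} :=
  (\bigcup_(u in U) A_ u :|: \bigcup_(v in V) B_ v :|: \bigcup_(w in W) C_ w
     :|: (if odd l then C_ 0 else finset.set0)) :\ 1%g.

(* m is the number of elements of X outside the sets A_ u, B_ v, C_ w. *)
Definition connection_set (l m : nat) (delta : int) (X : {set FFZ p n}) : Prop :=
  [/\ (1%g \notin X), (X^-1)%g = X, <<X>>%g = [set: FFZ p n],
      (#|X|%:Z = (l * p)%:Z + delta) &
      exists U V W : {set 'I_n.-1.+1}, exists E : {set FFZ p n},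
        [/\ 0 \notin U :|: V :|: W,
            X = base_set l U V W :|: E,
            [disjoint base_set l U V W & E] &
            #|E| = m]].

End ConnectionSets.

Definition admissible (n p : nat) : Prop :=
  [/\ prime p, coprime p p.-1, coprime p n & coprime p.-1 n].

(* The number m of extra elements does not depend on p. *)
Definition realizable (delta : int) (l n : nat) : Prop :=
  odd n /\
  exists m : nat, forall p : nat, admissible n p ->
    exists2 X : {set FFZ p n},
      connection_set l m delta X & has_diameter (cayley X) 2.

Definition is_nl (delta : int) (l n : nat) : Prop :=
  realizable delta l n /\
  (forall n', realizable delta l n' -> (n' <= n)%N).

Section Orders.
Variable R : realType.
Local Open Scope classical_set_scope.

(* The degree d = l p + delta determines p, so that this is the supremum of
   at most one value: the order of the graphs of degree d on G_l. It is -oo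
   if there is no such graph. *)
Definition CC_l (delta : int) (l d : nat) : \bar R :=
  ereal_sup [set N : \bar R | exists n p : nat,
    [/\ is_nl delta l n, admissible n p, d%:Z = (l * p)%:Z + delta &
        N = (#|{: FFZ p n}|%:R)%:E]].

Definition CC_G (delta : int) (d : nat) : \bar R :=
  ereal_sup [set CC_l delta l d | l in [set l | (3 <= l)%N]].

End Orders.

(* Main.v *)
(* Fix l and n.  For a large admissible prime p the connection set consists of
   sets A_u with u in U, B_v with v in V, C_w with w in W, and of m further
   elements, where m does not depend on p.  These m elements contribute only
   O(p) products of length two, so a fibre F^* x F^+ x {w}, which has about p^2
   elements, has to be covered by products of the sets.  The products B B and
   C C are too thin.  The products A_u A_v and A_u^-1 A_v^-1 are of the form
   (x y, x + y) and ((x y)^-1, - (x + y)): even together, they miss a positive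
   proportion of the fibre.  So w has to be one of the third coordinates of
   A_u A_u'^-1, A^+-1 B, A^+-1 C or B C, and counting these, with
   l >= 2 |U| + |+-V| + |+-W|, gives 8 n <= 3 l^2.

   Arbitrarily large admissible primes are provided by the primes p = -1 mod n,
   whose infinitude has a Euclid-style proof: Phi_n(a + b i, a - b i), suitably
   homogenized, is an integer, and its sign and its residue mod 4 can be
   arranged so that it has a prime factor p = 3 mod 4; then p = -1 mod n. *)
Require Import Defs.
From HB Require Import structures.
From mathcomp Require Import all_boot all_order all_algebra all_fingroup.
From mathcomp Require Import cyclic all_field.
From mathcomp Require Import all_classical all_reals all_analysis.
From mathcomp Require Import ring lra zify.

Set Implicit Arguments.
Unset Strict Implicit.
Unset Printing Implicit Defensive.

Import Order.TTheory GRing.Theory Num.Theory.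
Import numFieldNormedType.Exports.

Local Open Scope ring_scope.

(** * Primes congruent to -1 modulo n *)

(** The binary form of degree [(size P).-1] attached to [P]. It makes sense over every commutative
    ring, so that one integer value can be read both in [algC] and in characteristic [p]. *)
Definition homog (A : comNzRingType) (P : {poly int}) (x y : A) : A :=
  \sum_(j < size P) (P`_j)%:~R * x ^+ j * y ^+ ((size P).-1 - j).

Lemma rmorph_homog (A B : comNzRingType) (f : {rmorphism A -> B}) P x y :
  f (homog P x y) = homog P (f x) (f y).
Proof.
rewrite rmorph_sum; apply: eq_bigr => j _.
by rewrite !rmorphM !rmorphXn rmorph_int.
Qed.

Lemma homogE (F : fieldType) (P : {poly int}) (x y : F) : y != 0 ->
  homog P x y = y ^+ (size P).-1 * (map_poly intr P).[x / y].
Proof.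
move=> y0; rewrite (horner_coef_wide _ (size_poly _ _)) mulr_sumr.
apply: eq_bigr => j _; rewrite coef_map /= expr_div_n.
have jP : (j <= (size P).-1)%N by case: (size P) j => [[]|m j] //=; rewrite -ltnS.
rewrite -{2}(subnK jP) exprD.
have : y ^+ j != 0 by rewrite expf_neq0.
by move=> ?; field.
Qed.

(** [u + v X] is the remainder modulo [X^2 + 1], over the integers, of the form at [a + b X] and
    [a - b X]. Evaluation at any square root of -1 kills [X^2 + 1], so [u] and [v] do not depend on
    the ring. *)
Lemma homog_gauss (P : {poly int}) (a b : int) : exists u v : int,
  forall (A : comNzRingType) (i : A), i ^+ 2 = -1 ->
    homog P (a%:~R + b%:~R * i) (a%:~R - b%:~R * i) = u%:~R + v%:~R * i.
Proof.
pose m : {poly int} := 'X^2 - (-1)%:P.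
have mm : m \is monic by apply: monicXnsubC.
pose g := homog P (a%:~R + b%:~R * 'X) (a%:~R - b%:~R * 'X : {poly int}).
pose r := Pdiv.Ring.rmodp g m.
exists r`_0, r`_1 => A i i2.
have ci : commr_rmorph (intr : int -> A) i by move=> z; exact: mulrC.
have -> : homog P (a%:~R + b%:~R * i) (a%:~R - b%:~R * i) = horner_morph ci g.
  rewrite rmorph_homog rmorphB rmorphD rmorphM /= !rmorph_int.
  by rewrite horner_morphX.
rewrite {1}(Pdiv.RingMonic.rdivp_eq mm g) rmorphD rmorphM /= -/r.
have -> : horner_morph ci m = 0.
  by rewrite rmorphB rmorphXn /= horner_morphX horner_morphC i2 rmorphN subrr.
rewrite mulr0 add0r /horner_morph.
have sr : (size (map_poly intr r : {poly A}) <= 2)%N.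
  apply: leq_trans (size_poly _ _) _; rewrite -ltnS.
  apply: leq_trans (Pdiv.Ring.ltn_rmodpN0 _ (monic_neq0 mm)) _.
  by rewrite size_XnsubC.
rewrite (horner_coef_wide _ sr) big_ord_recr big_ord1 /= !coef_map /=.
by rewrite expr0 mulr1 expr1.
Qed.

(** * Values and roots of cyclotomic polynomials *)

Lemma Cyclotomic1 : 'Phi_1 = 'X - 1.
Proof. by rewrite -['X]expr1 -(prod_Cyclotomic (ltn0Sn 0)) big_seq1. Qed.

Lemma divisors_gt1 n : (1 < n)%N ->
  exists s, perm_eq (divisors n) [:: 1%N, n & s].
Proof.
move=> n1; have n0 : (0 < n)%N by apply: ltn_trans n1.
exists (rem n (rem 1%N (divisors n))).
have p1 : perm_eq (divisors n) (1%N :: rem 1%N (divisors n)).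
  by apply: perm_to_rem; rewrite -dvdn_divisors ?dvd1n.
apply: perm_trans p1 _; rewrite perm_cons; apply: perm_to_rem.
by rewrite mem_rem_uniq ?divisors_uniq // inE -dvdn_divisors // dvdnn gtn_eqF.
Qed.

(** At -1 the product of the ['Phi_d] over the divisors [d] of [n] is -2, and ['Phi_1] alone gives
    -2. The remaining integer factors have product 1, so each is a unit. *)
Lemma Cyclotomic_at_opp1 n : (1 < n)%N -> odd n -> `|('Phi_n).[-1]| = 1.
Proof.
move=> n1 on; have [s ps] := divisors_gt1 n1.
have := prod_Cyclotomic (ltnW n1).
rewrite (perm_big _ ps) /= !big_cons Cyclotomic1 => /(congr1 (horner^~ (-1))).
rewrite !hornerE -signr_odd on /=; set u := _.[_]; set v := _.[_] => E.
have /eqP : absz (u * v) = 1%N.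
  suff -> : u * v = 1 by [].
  apply: (@mulfI _ (-1 - 1 : int)) => //.
  by rewrite mulrA E mulr1 expr1.
by rewrite abszM muln_eq1 -abszE => /andP[/eqP -> _].
Qed.

(** [X^n - 1] is separable, so [x] is a root of only one of its factors. If the order [d] of [x]
    were not [n], then [x] would also be a root of some ['Phi_e] with [e] dividing [d]. *)
Lemma root_Cyclotomic_prim (F : fieldType) n (x : F) : (0 < n)%N ->
  n%:R != 0 :> F -> root (map_poly intr 'Phi_n) x -> n.-primitive_root x.
Proof.
move=> n0 nF rx.
have mapXn1 m : map_poly intr ('X^m - 1) = 'X^m - 1 :> {poly F}.
  by rewrite rmorphB /= rmorph1 map_polyXn.
have dvdX d m : (0 < m)%N -> (d %| m)%N ->
  map_poly intr ('Phi_d) %| ('X^m - 1 : {poly F}).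
  move=> m0 dm; rewrite -mapXn1 -(prod_Cyclotomic m0) (big_rem d) /=.
    by rewrite rmorphM dvdp_mulr.
  by rewrite -dvdn_divisors.
have xn : x ^+ n = 1.
  have /(root_dvdp (dvdX _ _ n0 (dvdnn n))) := rx.
  by rewrite rootE !hornerE subr_eq0 => /eqP.
have [d dp dn] := prim_order_exists n0 xn.
have d0 := prim_order_gt0 dp.
have [<- //|dNn] := eqVneq d n.
have : root (map_poly intr ('X^d - 1)) x.
  by rewrite mapXn1 rootE !hornerE (prim_expr_order dp) subrr.
rewrite -(prod_Cyclotomic d0) rmorph_prod rootE horner_prod prodf_seq_eq0.
case/hasP => e; rewrite -dvdn_divisors //= => ed re.
have eNn : e != n.
  by apply: contra_neq dNn => En; apply/eqP; rewrite eqn_dvd dn -En ed.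
have : separable_poly ('X^n - 1 : {poly F}) by rewrite separable_Xn_sub_1.
rewrite -mapXn1 -(prod_Cyclotomic n0) (big_rem n) -?dvdn_divisors //=.
rewrite rmorphM /= separable_mul => /and3P[_ _ /coprimep_root /(_ rx)].
rewrite (big_rem e) /=; last first.
  rewrite mem_rem_uniq ?divisors_uniq // inE eNn -dvdn_divisors //.
  exact: dvdn_trans ed dn.
by rewrite rmorphM hornerM mulf_eq0 re.
Qed.

Lemma norm_prim_root n (z : algC) : n.-primitive_root z -> `|z| = 1.
Proof.
move=> zP; apply/eqP; rewrite -(@pexpr_eq1 _ _ n) ?(prim_order_gt0 zP) //.
by rewrite -normrX (prim_expr_order zP) normr1.
Qed.

Section ComplexCyclotomic.
Variables (n : nat) (z : algC).
Hypothesis zP : n.-primitive_root z.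

Lemma homog_CyclotomicE (x y : algC) : y != 0 ->
  homog 'Phi_n x y = \prod_(k < n | coprime k n) (x - z ^+ k * y).
Proof.
move=> y0; rewrite homogE // (Cintr_Cyclotomic zP) horner_prod size_Cyclotomic.
have -> : (totient n).+1.-1 = #|[pred k : 'I_n | coprime k n]|.
  rewrite /= totient_count_coprime big_mkord -sum1_card [RHS]big_mkcond.
  by apply: eq_bigr => k _; rewrite coprime_sym inE.
rewrite -prodr_const -big_split; apply: eq_bigr => k _ /=.
by rewrite !hornerE mulrBr [y * (x / y)]mulrC divfK // [y * _]mulrC.
Qed.

(** Conjugation multiplies the factor for [k] by [- (z ^+ k)^*], hence the whole form by a constant
    [c] independent of [x]. The value at [x = 1] is real and nonzero, so [c = 1]. *)
Lemma homog_Cyclotomic_real (x : algC) : (1 < n)%N -> x != 0 ->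
  homog 'Phi_n x x^* \is Num.real.
Proof.
move=> n1 x0; pose c := \prod_(k < n | coprime k n) - (z ^+ k)^*.
have zk (k : nat) : z ^+ k * (z ^+ k)^* = 1.
  by rewrite -normCK normrX (norm_prim_root zP) !expr1n.
have conjE y : y != 0 -> (homog 'Phi_n y y^*)^* = c * homog 'Phi_n y y^*.
  move=> y0; rewrite homog_CyclotomicE ?conjC_eq0 // rmorph_prod -big_split.
  apply: eq_bigr => k _ /=; rewrite rmorphB rmorphM /= conjCK.
  by rewrite -{1}[y^*]mul1r -(zk k); ring.
have : homog 'Phi_n 1 1 != 0 :> algC.
  rewrite homog_CyclotomicE ?oner_neq0 //.
  have := root_cyclotomic zP 1; rewrite rootE horner_prod => E.
  have -> : \prod_(k < n | coprime k n) (1 - z ^+ k * 1)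
    = \prod_(i < n | coprime i n) ('X - (z ^+ i)%:P).[1].
    by apply: eq_bigr => k _; rewrite !hornerE.
  rewrite E; apply/negP => /prim_order_dvd/(_ 1%N).
  by rewrite expr1 eqxx dvdn1 => /eqP En; rewrite En in n1.
have := conjE 1 (oner_neq0 _); rewrite conjC1.
rewrite (rmorph_homog (Num.conj_op : {rmorphism algC -> algC})) /= conjC1.
move=> H h0; have c1 : c = 1 by apply: (mulIf h0); rewrite mul1r.
by apply/CrealP; rewrite conjE // c1 mul1r.
Qed.

End ComplexCyclotomic.

(** In [algC] the two arguments are conjugate, so the value [u + v i] is real and [v = 0]; this [v]
    is the same for all rings. *)
Lemma homog_Cyclotomic_int n (a b : int) : (1 < n)%N -> (a != 0) || (b != 0) ->
  exists u : int, forall (A : comNzRingType) (i : A), i ^+ 2 = -1 ->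
    homog 'Phi_n (a%:~R + b%:~R * i) (a%:~R - b%:~R * i) = u%:~R.
Proof.
move=> n1 ab; have [u [v E]] := homog_gauss 'Phi_n a b.
exists u => A i i2; rewrite E //.
suff -> : v = 0 by rewrite mul0r addr0.
have [z zP] := C_prim_root_exists (ltnW n1).
have ar : (a%:~R : algC) \is Num.real by rewrite realz.
have br : (b%:~R : algC) \is Num.real by rewrite realz.
have := homog_Cyclotomic_real zP (x := a%:~R + b%:~R * 'i) n1.
rewrite [b%:~R * _]mulrC conjC_rect // [_ * b%:~R]mulrC E ?sqrCi //.
rewrite mulrC; set x := _ + _ => H.
have : x != 0.
  apply/eqP => x0; move: (congr1 (fun y => 'Re y) x0) (congr1 (fun y => 'Im y) x0).
  rewrite Re_rect // Im_rect // !raddf0 => /eqP + /eqP.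
  by rewrite !intr_eq0 => A0 B0; rewrite (eqP A0) (eqP B0) in ab.
move/H; rewrite mulrC => /Creal_ImP; rewrite Im_rect ?realz // => /eqP.
by rewrite intr_eq0 => /eqP.
Qed.

(** * Sign change of the cyclotomic form at rational points *)

Lemma poly_lipschitz (K : numFieldType) (q : {poly K}) (x0 : K) :
  exists2 C, 0 <= C &
    forall x, `|x - x0| <= 1 -> `|q.[x] - q.[x0]| <= C * `|x - x0|.
Proof.
have /factor_theorem[r Er] : root (q - q.[x0]%:P) x0.
  by rewrite rootE !hornerE subrr.
(* This constant bounds the quotient of [q - q(x0)] by [X - x0] on the unit disc around [x0]. *)
exists (\sum_(i < size r) `|r`_i| * (`|x0| + 1) ^+ i).
  by rewrite sumr_ge0 // => i _; rewrite mulr_ge0 ?exprn_ge0 ?addr_ge0.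
move=> x xx0; have := congr1 (horner^~ x) Er; rewrite !hornerE => ->.
rewrite normrM ler_wpM2r // horner_coef.
apply: le_trans (ler_norm_sum _ _ _) _; apply: ler_sum => i _.
rewrite normrM normrX ler_wpM2l // lerXn2r ?nnegrE ?addr_ge0 //.
by rewrite -[x](subrK x0) addrC (le_trans (ler_normD _ _)) // lerD2l.
Qed.

(* b is a power of M + 1 and a = M + M (M + 1) j, so that a and b have no common
   prime factor. *)
Lemma congruent_fractions_dense (M : nat) (t e : algC) :
  (0 < M)%N -> t \is Num.real -> 0 < e -> exists a1 a2 b : int,
  [/\ 0 < b, forall a, a = a1 \/ a = a2 ->
        [/\ forall p : nat, prime p -> (p %| a)%Z -> ~~ (p %| b)%Z,
            (M %| a)%Z & (M %| b - 1)%Z],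
      t - e <= a1%:~R / b%:~R < t & t < a2%:~R / b%:~R <= t + e].
Proof.
move=> M0 tr e0; pose W : algC := (M * M.+1)%:R.
have W0 : 0 < W by rewrite ltr0n muln_gt0 M0.
pose k := Num.bound (2 * W / e); pose b := M.+1%:Z ^+ k.
have b0 : 0 < b by rewrite /b exprn_gt0.
have bC0 : 0 < b%:~R :> algC by rewrite ltr0z.
have We : 2 * W / b%:~R <= e.
  rewrite ler_pdivrMr // [e * _]mulrC -ler_pdivrMr // ltW //.
  have : 2 * W / e < k%:R.
    by rewrite archi_boundP // divr_ge0 ?mulr_ge0 ?ltW // ler0n.
  move/lt_trans; apply; rewrite /b rmorphXn /= -pmulrn -natrX ltr_nat.
  exact: ltn_expl.
(* [y] solves [(M + W y) / b = t], so the fractions [a d / b] form a grid of step [W / b <= e / 2]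
   around [t]. On the left the shift is -1, since [j] itself gives equality when [y] is an
   integer. *)
pose y := (t * b%:~R - M%:R) / W.
have yr : y \is Num.real.
  by rewrite rpredM ?rpredV ?rpredB ?rpredM ?rpred_nat ?realz ?realn.
pose j := Num.floor y; have /andP[jy yj] := real_floor_itv yr.
pose a (d : int) : int := M%:Z + (M * M.+1)%:Z * (j + d).
exists (a (- 1)), (a 1), b.
have aE d : (a d)%:~R / b%:~R = t + W * (j%:~R + d%:~R - y) / b%:~R.
  rewrite /a /y !rmorphD !rmorphM rmorphD /= -!pmulrn /W.
  have := lt0r_neq0 bC0; have := lt0r_neq0 W0; rewrite /W => ? ?.
  by field; rewrite (lt0r_neq0 bC0) nat1r !pnatr_eq0 -!lt0n M0.
have bnd (x : algC) : -2 <= x <= 2 -> t - e <= t + W * x / b%:~R <= t + e.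
  move=> /andP[x1 x2]; rewrite !lerD2l; apply/andP; split.
    apply: le_trans (_ : - (2 * W / b%:~R) <= _); first by rewrite lerN2.
    by rewrite -mulNr ler_pM2r ?invr_gt0 // -mulNr mulrC ler_pM2l.
  apply: le_trans We; rewrite ler_pM2r ?invr_gt0 // mulrC ler_pM2r //.
have Wx (x : algC) : (0 < W * x / b%:~R) = (0 < x).
  by rewrite pmulr_lgt0 ?invr_gt0 // pmulr_rgt0.
have Wx' (x : algC) : (W * x / b%:~R < 0) = (x < 0).
  by rewrite pmulr_llt0 ?invr_gt0 // pmulr_rlt0.
rewrite rmorphD /= -/j -ltrBlDl in yj; rewrite -/j -subr_ge0 in jy.
have f1 d : j%:~R + d%:~R - y = d%:~R - (y - j%:~R) by ring.
split=> //.
- move=> c H; have {H}[d ->] : exists d, c = a d by case: H => ->; eexists.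
  split.
  + move=> p pp pa; rewrite /b dvdzE abszX Euclid_dvdX //=.
    apply/negP => /andP[pM _].
    have ME : a d - M.+1%:Z * (M%:Z * (j + d)) = M.
      by rewrite /a mulnC PoszM -mulrA addrK.
    have : (p %| a d - M.+1%:Z * (M%:Z * (j + d)))%Z.
      by rewrite rpredB // dvdz_mulr.
    rewrite ME dvdzE /= => pM'.
    by move: pM; rewrite -addn1 dvdn_addr // dvdn1 => /eqP Ep; rewrite Ep in pp.
  + by rewrite rpredD ?dvdzz // PoszM -mulrA dvdz_mulr.
  + by rewrite /b subrX1 dvdz_mulr // -addn1 PoszD addrK.
- rewrite aE gtrDl Wx' f1 rmorphN1 subr_lt0 (lt_le_trans _ jy) ?ltrN10 // andbT.
  suff /bnd/andP[-> //] : -2 <= -1 - (y - j%:~R) <= 2.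
  have -> : -2 = -1 - 1 :> algC by ring.
  rewrite lerD2l lerN2 (ltW yj) lerBlDr (le_trans (lerN10 _)) //.
  by rewrite addr_ge0.
- rewrite aE ltrDl Wx f1 subr_gt0 yj /=.
  suff /bnd/andP[_ ->] : -2 <= 1 - (y - j%:~R) <= 2 by [].
  apply/andP; split; last by rewrite lerBlDr (le_trans (ler1n _ 2)) // lerDl.
  by rewrite lerBrDr -lerBrDl (le_trans (ltW yj)) // opprK lerDl.
Qed.

(* As a function of t, the homogenization of Phi_n at (t + i, t - i) has the
   simple real root i (1 + z) / (z - 1), where it changes sign. *)
Lemma homog_Cyclotomic_sign (n M : nat) (s : int) : (1 < n)%N -> (0 < M)%N ->
  `|s| = 1 -> exists a b u : int,
  [/\ forall p : nat, prime p -> (p %| a)%Z -> ~~ (p %| b)%Z,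
      (M %| a)%Z, (M %| b - 1)%Z, s * u < 0 &
      forall (A : comNzRingType) (i : A), i ^+ 2 = -1 ->
        homog 'Phi_n (a%:~R + b%:~R * i) (a%:~R - b%:~R * i) = u%:~R].
Proof.
move=> n1 M0 s1; have [z zP] := C_prim_root_exists (ltnW n1).
have z1 : 1 - z != 0.
  rewrite subr_eq0 eq_sym; apply/eqP => z1; have := prim_order_dvd zP 1.
  by rewrite expr1 z1 eqxx dvdn1 => /eqP En; rewrite En in n1.
have zz : z * z^* = 1 by rewrite -normCK (norm_prim_root zP) expr1n.
pose t : algC := - 'i * (1 + z) / (1 - z).
have t1E : t + 'i = z * (t - 'i) by rewrite /t; field.
have tr : t \is Num.real.
  have z0 : z != 0 by rewrite (prim_root_eq0 zP) -lt0n ltnW.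
  have zc : z^* = z^-1 by apply: (mulfI z0); rewrite zz mulfV.
  apply/CrealP; rewrite /t !rmorphM fmorphV !rmorphD !rmorphN rmorph1 /=.
  rewrite conjCi zc; field; rewrite z0 z1 /=.
  by rewrite subr_eq0 -subr_eq0 -opprB oppr_eq0.
pose k1 := Ordinal n1.
(* [(X - t) q] is the form at [X + i] and [X - i]: the factor for [k = 1] equals [(1 - z) (X - t)],
   and [q] keeps [1 - z] and the other factors. *)
pose q : {poly algC} := (1 - z)%:P * \prod_(k < n | coprime k n && (k != k1))
  ('X + 'i%:P - (z ^+ k)%:P * ('X - 'i%:P)).
have qt0 : q.[t] != 0.
  rewrite /q hornerM hornerC mulf_neq0 // horner_prod prodf_seq_neq0.
  apply/allP => k _; apply/implyP => /andP[_ kk1].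
  rewrite !hornerE t1E -mulrBl mulf_neq0 //.
    rewrite subr_eq0 -{1}[z]expr1 (eq_prim_root_expr zP) eq_sym.
    by rewrite !modn_small.
  apply/eqP => t0; move: t1E; rewrite t0 mulr0 => t1.
  have : 2 * 'i = 0 :> algC by rewrite -[RHS]subr0 -{2}t0 -t1; ring.
  by move/eqP; rewrite mulf_eq0 (negPf (neq0Ci _)) pnatr_eq0.
(* Up to a positive power of [b], the value [u] is [(x - t) q(x)] at [x = a / b]. *)
have hq (a b u : int) : 0 < b ->
    (homog 'Phi_n (a%:~R + b%:~R * 'i) (a%:~R - b%:~R * 'i) = u%:~R :> algC) ->
    exists2 c : algC, 0 < c &
      u%:~R = c * ((a%:~R / b%:~R - t) * q.[a%:~R / b%:~R]).
  move=> b0 <-; have bC : b%:~R != 0 :> algC by rewrite intr_eq0 gt_eqF.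
  exists (b%:~R ^+ #|[pred k : 'I_n | coprime k n]|).
    by rewrite exprn_gt0 // ltr0z.
  rewrite (homog_CyclotomicE zP); last first.
    apply/eqP => H; move: (congr1 (fun y => 'Im y) H).
    rewrite -mulNr mulrC Im_rect ?rpredN ?realz // raddf0 => /eqP.
    by rewrite oppr_eq0 (negPf bC).
  have [x xE] : exists x, x = a%:~R / b%:~R :> algC by eexists.
  rewrite -xE; have -> : a%:~R = b%:~R * x :> algC by rewrite xE mulrC divfK.
  rewrite -prodr_const.
  rewrite (bigD1 k1) ?coprime1n //= [in RHS](bigD1 k1) ?inE ?coprime1n //=.
  rewrite /q hornerM hornerC horner_prod.
  transitivity (b%:~R * ((x - t) * (1 - z)) *
    \prod_(k < n | coprime k n && (k != k1))
     (b%:~R * ('X + 'i%:P - (z ^+ k)%:P * ('X - 'i%:P)).[x])).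
    congr (_ * _); last by apply: eq_bigr => k _; rewrite !hornerE; ring.
    by rewrite expr1 /t; field.
  rewrite big_split /=; ring.
have [C C0 qC] := poly_lipschitz q t.
(* [e] is at most 1, as [poly_lipschitz] requires, and satisfies [3 C e < |q(t)|]. *)
pose e := `|q.[t]| / (3 * C + 3 + `|q.[t]|).
have d0 : 0 < 3 * C + 3 + `|q.[t]|.
  by rewrite addr_gt0 ?normr_gt0 // ltr_wpDl // mulr_ge0.
have e0 : 0 < e by rewrite divr_gt0 ?normr_gt0.
have e1 : e <= 1.
  by rewrite ler_pdivrMr // mul1r lerDr addr_ge0 ?mulr_ge0.
have [a1 [a2 [b [b0 ab /andP[a1l a1t] /andP[ta2 a2l]]]]] :=
  congruent_fractions_dense M0 tr e0.
have b1 : b != 0 by rewrite gt_eqF.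
have [u1 E1] := homog_Cyclotomic_int (a := a1) n1 (introT orP (or_intror b1)).
have [u2 E2] := homog_Cyclotomic_int (a := a2) n1 (introT orP (or_intror b1)).
have [su1|su1] := ltP (s * u1) 0.
  by exists a1, b, u1; have [] := ab a1 (or_introl erefl).
have [su2|su2] := ltP (s * u2) 0.
  by exists a2, b, u2; have [] := ab a2 (or_intror erefl).
(* Otherwise [s u1] and [s u2] are both nonnegative while [x - t] changes sign, so [q] has opposite
   weak signs at [x1] and [x2], although both values are within [C e] of [q(t)]. *)
have [c1 c10 F1] := hq _ _ _ b0 (E1 _ _ (sqrCi _)).
have [c2 c20 F2] := hq _ _ _ b0 (E2 _ _ (sqrCi _)).
have x1l : `|a1%:~R / b%:~R - t| <= e.
  by rewrite ltr0_norm ?subr_lt0 // opprB lerBlDr -lerBlDl.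
have x2l : `|a2%:~R / b%:~R - t| <= e.
  by rewrite gtr0_norm ?subr_gt0 // lerBlDl.
set x1 := a1%:~R / _ in F1 x1l a1t; set x2 := a2%:~R / _ in F2 x2l ta2.
have q1 : s%:~R * q.[x1] <= 0.
  have : 0 <= s%:~R * u1%:~R :> algC by rewrite -rmorphM ler0z.
  rewrite F1 !mulrA [_ * c1]mulrC -!mulrA pmulr_rge0 // mulrCA.
  by rewrite nmulr_rge0 // subr_lt0.
have q2 : 0 <= s%:~R * q.[x2].
  have : 0 <= s%:~R * u2%:~R :> algC by rewrite -rmorphM ler0z.
  rewrite F2 !mulrA [_ * c2]mulrC -!mulrA pmulr_rge0 // mulrCA.
  by rewrite pmulr_rge0 // subr_gt0.
have sn : `|s%:~R| = 1 :> algC by rewrite -intr_norm s1.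
have q12 : `|q.[x2]| <= `|q.[x2] - q.[x1]|.
  rewrite -[leRHS]mul1r -[leLHS]mul1r -sn -!normrM mulrBr.
  rewrite !ger0_norm ?subr_ge0 ?(le_trans q1) //.
  by rewrite lerDl oppr_ge0.
have {}x1l := le_trans (qC _ (le_trans x1l e1)) (ler_wpM2l C0 x1l).
have {}x2l := le_trans (qC _ (le_trans x2l e1)) (ler_wpM2l C0 x2l).
have : `|q.[t]| <= 3 * (C * e).
  have -> : 3 * (C * e) = C * e + (C * e + C * e) :> algC by ring.
  rewrite -[X in `|X|](subrK q.[x2]) (le_trans (ler_normD _ _)) // lerD //.
    by rewrite distrC.
  have E : q.[x2] - q.[x1] = (q.[x2] - q.[t]) - (q.[x1] - q.[t]) by ring.
  apply: le_trans q12 _; rewrite E.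
  by rewrite (le_trans (ler_normB _ _)) ?lerD.
suff H : 3 * (C * e) < `|q.[t]| by rewrite (lt_geF H).
rewrite /e !mulrA ltr_pdivrMr // [ltRHS]mulrC.
by rewrite ltr_pM2r ?normr_gt0 // -addrA ltrDl addr_gt0 ?normr_gt0.
Qed.

(** * Prime factors congruent to -1 modulo n *)

Lemma homog_eqAmod (P : {poly int}) (e x x' y y' : algC) :
  x \in Aint -> x' \in Aint -> y \in Aint -> y' \in Aint ->
  (x == x' %[mod e])%A -> (y == y' %[mod e])%A ->
  (homog P x y == homog P x' y' %[mod e])%A.
Proof.
move=> Ax Ax' Ay Ay' xx' yy'.
have eqX v v' k : v \in Aint -> v' \in Aint ->
    (v == v' %[mod e])%A -> (v ^+ k == v' ^+ k %[mod e])%A.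
  move=> Av Av' vv'; elim: k => [|k IH]; first by rewrite !expr0 eqAmod_refl.
  by rewrite !exprS eqAmodM // rpredX.
rewrite /homog; elim/big_ind2: _ => [|? ? ? ? ? ?|j _].
- exact: eqAmod_refl.
- exact: eqAmodD.
apply: eqAmodM; rewrite ?rpredM ?rpredX ?Aint_int //; last exact: eqX.
by apply: eqAmodMl; rewrite ?Aint_int //; apply: eqX.
Qed.

Lemma prime_factor_3mod4 N : N = 3 %[mod 4] ->
  exists2 p, prime p & (p %| N)%N /\ p = 3 %[mod 4].
Proof.
elim/ltn_ind: N => N IH N3.
have N1 : (1 < N)%N by case: N N3 {IH} => [|[]].
have pp := pdiv_prime N1; have /dvdnP[m Em] := pdiv_dvd N.
set p := pdiv N in pp Em; have p1 := prime_gt1 pp.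
have [p3|p3] := eqVneq (p %% 4)%N 3%N.
  by exists p => //; rewrite Em dvdn_mull.
have op : odd p.
  have : odd N by rewrite (divn_eq N 4) N3 oddD oddM andbF.
  by rewrite Em oddM => /andP[].
have p1' : (p %% 4 = 1)%N.
  have : odd (p %% 4) by rewrite (divn_eq p 4) oddD oddM andbF in op.
  by have := ltn_pmod p (isT : (0 < 4)%N); case: (p %% 4)%N p3 => [|[|[|[]]]].
have m3 : m = 3 %[mod 4].
  by rewrite -N3 Em -modnMmr p1' muln1.
have mN : (m < N)%N.
  by rewrite Em -{1}[m]muln1 ltn_pmul2l //; case: (m) m3.
have [r rp [rm r3]] := IH m mN m3.
by exists r => //; rewrite Em dvdn_mulr.
Qed.

Lemma sqrt_opp1_field p : prime p ->
  exists2 L : fieldType, p \in [pchar L] & exists i : L, i ^+ 2 = -1.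
Proof.
move=> pp; have [K [f _]] := countable_algebraic_closure 'F_p.
exists K; first by rewrite (rmorph_pchar f) // pchar_Fp.
have [i Ei] := @solve_monicpoly K 2 (fun j => if j is 0%N then -1 else 0) isT.
by exists i; rewrite Ei !big_ord_recl big_ord0 /= mul0r !addr0 mulr1.
Qed.

(* The Frobenius of a field of characteristic p = 3 mod 4 acts on a + b i as
   complex conjugation. *)
Lemma dvdn_succ_prime_homog (n p : nat) (a b u : int) :
  (0 < n)%N -> prime p -> p = 3 %[mod 4] -> ~~ (p %| n)%N ->
  ((p %| a)%Z -> ~~ (p %| b)%Z) -> (p %| u)%Z ->
  (forall (A : comNzRingType) (i : A), i ^+ 2 = -1 ->
     homog 'Phi_n (a%:~R + b%:~R * i) (a%:~R - b%:~R * i) = u%:~R) ->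
  (n %| p.+1)%N.
Proof.
move=> n0 pp p3 pn pab pu E; have [L cL [i i2]] := sqrt_opp1_field pp.
have int0 (c : int) : ((c%:~R : L) == 0) = (p %| c)%Z by rewrite (dvdz_pcharf cL).
have nL : n%:R != 0 :> L by rewrite -(dvdn_pcharf cL).
have two : 2%:R != 0 :> L.
  rewrite -(dvdn_pcharf cL); apply/negP => /(dvdn_leq (isT : (0 < 2)%N)) p2.
  by case: p p2 pp p3 {pn pab pu E cL int0} => [|[|[|]]].
have i0 : i != 0.
  apply/eqP => i0; move: i2; rewrite i0 expr0n => /esym/eqP.
  by rewrite oppr_eq0 oner_eq0.
set x := a%:~R + b%:~R * i; set y := a%:~R - b%:~R * i.
have Exy : homog 'Phi_n x y = 0 by rewrite E //; apply/eqP; rewrite int0.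
have xy0 : x = 0 -> y = 0 -> False.
  move=> x0 y0; have : 2%:R * a%:~R = 0 :> L.
    by rewrite -[RHS]addr0 -{1}x0 -y0 /x /y; ring.
  have : 2%:R * i * b%:~R = 0 :> L.
    by rewrite -[RHS]subr0 -{1}x0 -y0 /x /y; ring.
  move=> /eqP; rewrite !mulf_eq0 (negPf two) (negPf i0) /= int0 => B0.
  move=> /eqP; rewrite mulf_eq0 (negPf two) /= int0 => A0.
  by move: (pab A0); rewrite B0.
have iP : i ^+ p = - i.
  have -> : p = (p %/ 4 * 4 + 3)%N by rewrite {1}(divn_eq p 4) p3.
  rewrite exprD mulnC exprM (_ : i ^+ 4 = 1) ?expr1n ?mul1r; last first.
    by rewrite (exprM i 2 2) i2 sqrrN expr1n.
  by rewrite exprS i2 mulrN1.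
have xp : x ^+ p = y.
  rewrite -(pFrobenius_autE cL) rmorphD rmorphM !rmorph_int /= pFrobenius_autE.
  by rewrite iP mulrN.
have yp : y ^+ p = x.
  rewrite -(pFrobenius_autE cL) rmorphB rmorphM !rmorph_int /= pFrobenius_autE.
  by rewrite iP mulrN opprK.
have p0 := prime_gt0 pp.
have y0 : y != 0.
  apply/eqP => y0; apply: (xy0 _ y0).
  by rewrite -yp y0 expr0n gtn_eqF.
have x0 : x != 0.
  apply: contraNneq y0 => x0.
  by rewrite -xp x0 expr0n gtn_eqF.
(* [x / y] has order [n], and since the [p]-th power exchanges [x] and [y], its power [p + 1] is
   1. *)
have : n.-primitive_root (x / y).
  apply: root_Cyclotomic_prim => //.
  move/eqP: Exy; rewrite homogE // mulf_eq0 expf_eq0 (negPf y0) andbF /=.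
  by rewrite rootE.
move/prim_order_dvd => ->; rewrite exprS expr_div_n xp yp.
by apply/eqP; field; rewrite x0 y0.
Qed.

(** With [a = 0] and [b = 1] modulo [M], the value [u] is congruent to [u0], which is 1 or -1, and
    has the opposite sign, so [|u| = -1] modulo [M]. The factor 4 of [M] yields a prime factor
    [p = 3] modulo 4 of [u]; the factors [n] and [B!] ensure that [p] does not divide [n] and
    exceeds [B]. *)
Lemma prime_eq_opp1_mod (n B : nat) : (1 < n)%N -> odd n ->
  exists2 p, prime p & (B < p)%N /\ (n %| p.+1)%N.
Proof.
move=> n1 on; have n0 := ltnW n1; pose M := (4 * n * B`!)%N.
have M0 : (0 < M)%N by rewrite !muln_gt0 n0 fact_gt0.
have [u0 E0] := homog_Cyclotomic_int (a := 0) (b := 1) n1 isT.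
(* [u0] is the form at [i] and [-i], that is, a power of [-i] times the value of ['Phi_n] at -1. *)
have u01 : `|u0| = 1.
  apply: (@intr_inj algC); rewrite intr_norm -(E0 _ 'i (sqrCi _)).
  rewrite mulr0z mulr1z add0r sub0r mul1r homogE ?oppr_eq0 ?neq0Ci //.
  rewrite invrN mulrN divff ?neq0Ci // normrM normrX normrN.
  have -> : -1 = (-1)%:~R :> algC by rewrite rmorphN1.
  rewrite horner_map /= -intr_norm Cyclotomic_at_opp1 // mulr1.
  by rewrite normCi expr1n.
have [a [b [u [ab Ma Mb us Eu]]]] := homog_Cyclotomic_sign n1 M0 u01.
have Mu : (M %| u - u0)%Z.
  have Ai : 'i \in Aint.
    apply: (@Aint_unity_root 4) => //; apply/unity_rootP.
    by rewrite (exprM _ 2 2) sqrCi sqrrN expr1n.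
  have /andP[ea eb] : ((a%:~R : algC) == 0%:~R %[mod M%:R])%A &&
                      ((b%:~R : algC) == 1%:~R %[mod M%:R])%A.
    have toA (c : int) : (M %| c)%Z -> (M%:R %| (c%:~R : algC))%A.
      move=> /dvdzP[d ->]; rewrite rmorphM /= -eqAmod0 eqAmodMl0 //.
      by rewrite Aint_int.
    by rewrite /eqAmod -!rmorphB /= subr0 !toA.
  have : ((u%:~R : algC) == u0%:~R %[mod M%:R])%A.
    rewrite -(Eu _ 'i (sqrCi _)) -(E0 _ 'i (sqrCi _)).
    apply: homog_eqAmod; rewrite ?(rpredD, rpredN, rpredM) ?Aint_int //.
      by apply: eqAmodD => //; apply: eqAmodMr.
    by apply: eqAmodD => //; rewrite eqAmodN opprK; apply: eqAmodMr.
  rewrite eqAmod_rat ?rpred_nat ?rpred_int // /eqCmod -rmorphB /=.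
  by rewrite dvdC_int ?rpred_int // intrKfloor dvdzE.
have MN : (M %| (absz u).+1)%N.
  have -> : (absz u).+1 = absz (u0 * (u - u0)) by nia.
  by rewrite abszM dvdn_mull.
have N3 : absz u = 3 %[mod 4].
  have : (4 %| (absz u).+1)%N.
    by apply: dvdn_trans MN; rewrite /M -mulnA dvdn_mulr.
  lia.
have [p pp [pu p3]] := prime_factor_3mod4 N3.
have pM : ~~ (p %| M)%N.
  apply/negP => /dvdn_trans/(_ MN); rewrite -addn1 dvdn_addr // dvdn1 => /eqP Ep.
  by rewrite Ep in pp.
exists p => //; split.
  rewrite ltnNge; apply: contra pM => pB; rewrite /M dvdn_mull //.
  by rewrite dvdn_fact // prime_gt0.
apply: (dvdn_succ_prime_homog n0 pp p3 _ (ab p pp) _ Eu); last by rewrite dvdzE.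
by apply: contra pM => pn; rewrite /M mulnAC dvdn_mull.
Qed.

(** * Pairs missed by the products A A and A^-1 A^-1 *)

Local Notation uval := FinRing.uval.

Section UncoveredPairs.
Variable F : finFieldType.

(** If [x y = r^2], then [(x + y) / r = h + 1 / h] with [h = x / r]; so for [z] in this set,
    [(r^2, r z)] is not of the form [(x y, x + y)]. *)
Definition nonsum_inv : {set F} :=
  [set z | [forall h : F, (h != 0) ==> (z != h + h^-1)]].

(** [h] and [1 / h] give the same sum, and they coincide for at most two [h]. [H1] keeps the one of
    lower rank, so its image is still the whole range of [h + 1 / h]. *)
Lemma card_nonsum_inv : (#|F| <= 2 * #|nonsum_inv| + 1)%N.
Proof.
pose H1 := [set h : F | (h != 0) && (enum_rank h <= enum_rank h^-1)%N].
pose H2 := [set h : F | (h != 0) && (enum_rank h^-1 <= enum_rank h)%N].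
pose J := [set h + h^-1 | h in H1].
have H12 : #|H2| = #|H1|.
  rewrite -(card_imset H1 invr_inj); congr #|pred_of_set _|.
  apply/finset.setP => h; rewrite -[in RHS](invrK h) mem_imset ?inE; last first.
    exact: invr_inj.
  by rewrite invr_eq0 invrK.
have NJ : ~: nonsum_inv \subset J.
  apply/fintype.subsetP => z; rewrite !inE negb_forall => /existsP[h].
  rewrite negb_imply negbK => /andP[h0 /eqP ->].
  have [le|lt] := leqP (enum_rank h) (enum_rank h^-1).
    by apply/imsetP; exists h; rewrite ?inE ?h0.
  apply/imsetP; exists h^-1; rewrite ?inE ?invr_eq0 ?h0 ?invrK ?(ltnW lt) //.
  exact: addrC.
have : (#|~: nonsum_inv| <= #|H1|)%N.
  by apply: leq_trans (subset_leq_card NJ) _; apply: leq_imset_card.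
have := cardsUI H1 H2; rewrite H12.
have : (#|H1 :&: H2| <= 2)%N.
  have : H1 :&: H2 \subset [set 1; -1].
    apply/fintype.subsetP => h; rewrite !inE => /andP[/andP[h0 le1] /andP[_ le2]].
    have /eqP : h = h^-1.
      by apply/enum_rank_inj/val_inj/eqP; rewrite eqn_leq le1 le2.
    by rewrite -(inj_eq (mulfI h0)) divff // -expr2 sqrf_eq1.
  by move/subset_leq_card/leq_trans; apply; rewrite cards2; case: eqP.
have : (#|H1 :|: H2| < #|F|)%N.
  rewrite -cardsT; apply: proper_card; apply/properP.
  split; first exact: finset.subsetT.
  by exists 0; rewrite ?inE ?eqxx.
have := cardsC nonsum_inv.
move: #|_ :|: _| #|_ :&: _| #|~: _| #|H1| #|nonsum_inv| #|F| => *; lia.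
Qed.

(** Every nonzero element is a square times 1 or a generator [g] of the cyclic group [F^*]; [M] is
    the larger of the two corresponding subsets of [N :\ 0]. *)
Lemma square_class_half (N : {set F}) : exists2 M : {set F},
  (#|N| <= 2 * #|M| + 1)%N &
  M \subset N :\ 0 /\
  {in M &, forall z w, exists r : {unit F}, w = uval r ^+ 2 * z}.
Proof.
have /cyclicP[g gP] : cyclic [set: {unit F}] by apply: field_unit_group_cyclic.
have exg (x : F) : x != 0 -> exists k, x = val g ^+ k.
  rewrite -unitfE => ux.
  have /cycleP[k] : FinRing.unit F ux \in <[g]>%g by rewrite -gP inE.
  by move/(congr1 val); rewrite /= FinRing.val_unitX => ->; exists k.
pose M (b : bool) := [set x in N :\ 0 |
  [exists r : {unit F}, x == val r ^+ 2 * val g ^+ b]].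
have MN b : M b \subset N :\ 0.
  by apply/fintype.subsetP => x; rewrite inE => /andP[].
have Mr b : {in M b &, forall z w, exists r : {unit F}, w = uval r ^+ 2 * z}.
  move=> z w; rewrite inE => /andP[_ /existsP[r1 /eqP ->]].
  rewrite inE => /andP[_ /existsP[r2 /eqP ->]].
  exists (r2 * r1^-1)%g; rewrite mulrA -exprMn.
  by rewrite -[val _ * _]/(val (r2 * r1^-1 * r1)%g) mulgKV.
have cM : (#|N| <= #|M false| + #|M true| + 1)%N.
  have : N \subset [set 0] :|: (M false :|: M true).
    apply/fintype.subsetP => x xN; rewrite finset.in_setU finset.in_set1.
    have [//|x0] := eqVneq x 0; rewrite !inE x0 xN /=.
    have [k Ek] := exg x x0.
    have E : x = val (g ^+ k./2)%g ^+ 2 * val g ^+ odd k.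
      rewrite FinRing.val_unitX -exprM -exprD Ek; congr (_ ^+ _).
      by rewrite muln2 addnC odd_double_half.
    by case: (odd k) E => E; apply/orP; [right|left]; apply/existsP;
      exists (g ^+ k./2)%g; rewrite -E.
  move/subset_leq_card/leq_trans; apply.
  rewrite (leq_trans (leq_card_setU _ _)) // cards1 addnC leq_add2r.
  exact: leq_card_setU.
by have [le|/ltnW le] := leqP #|M false| #|M true|;
  [exists (M true) => //|exists (M false) => //]; lia.
Qed.

(* The pairs (s, t) that are neither of the form (x y, x + y) nor of the form
   ((x y)^-1, - (x + y)). *)
Definition nonsum_pairs : {set {unit F} * F} :=
  [set st | [&& st.2 != 0,
    [forall x : {unit F}, [forall y : {unit F},
       (st.1 == x * y)%g ==> (st.2 != uval x + uval y)]] &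
    [forall x : {unit F}, [forall y : {unit F},
       (st.1 == (x * y)^-1)%g ==> (st.2 != - (uval x + uval y))]]]].

(* s = r^2 and t = r z, with z and w = r^2 z both outside the range of
   h + 1/h; then (s, t) determines z^2 = t^2/s and w^2 = t^2 s. *)
Lemma card_nonsum_pairs : ((#|F| - 3) ^ 2 <= 64 * #|nonsum_pairs|)%N.
Proof.
have [M cM [MN Mr]] := square_class_half nonsum_inv.
pose Q := [set z ^+ 2 | z in M].
have cQ : (#|M| <= 2 * #|Q|)%N.
  have -> : #|M| = (\sum_(y in Q) #|M :&: [set z | z ^+ 2 == y]|)%N.
    rewrite -sum1_card (partition_big_imset (fun z => z ^+ 2)) /=.
    apply: eq_bigr => y _; rewrite -sum1_card; apply: eq_bigl => z.
    by rewrite !inE.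
  rewrite mulnC -sum_nat_const; apply: leq_sum => y /imsetP[z zM ->].
  have : M :&: [set x | x ^+ 2 == z ^+ 2] \subset [set z; - z].
    by apply/fintype.subsetP => x; rewrite !inE eqf_sqr => /andP[].
  by move/subset_leq_card/leq_trans; apply; rewrite cards2; case: eqP.
pose f (st : {unit F} * F) := (st.2 ^+ 2 / uval st.1, st.2 ^+ 2 * uval st.1).
have : finset.setX Q Q \subset f @: nonsum_pairs.
  apply/fintype.subsetP => -[_ _] /finset.setXP[/imsetP[z zM ->] /imsetP[w wM ->]].
  have [r wE] := Mr _ _ zM wM.
  have r0 : uval r != 0 :> F by rewrite -unitfE (valP r).
  have uE (x : {unit F}) : uval x != 0 :> F by rewrite -unitfE (valP x).
  have /andP[z0 zN] : (z != 0) && (z \in nonsum_inv).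
    by have := fintype.subsetP MN z zM; rewrite !inE.
  have /andP[_ wN] : (w != 0) && (w \in nonsum_inv).
    by have := fintype.subsetP MN w wM; rewrite finset.in_setD1.
  apply/imsetP; exists ((r * r)%g, uval r * z); last first.
    by rewrite /f /= wE; congr (_, _); field.
  rewrite inE /= mulf_neq0 //=; apply/andP; split.
    apply/forallP => x; apply/forallP => y; apply/implyP => /eqP /(congr1 val) /= E.
    apply/negP => /eqP E'.
    move: zN; rewrite inE => /forallP/(_ (uval x / uval r))/implyP.
    move/(_ (mulf_neq0 (uE x) (invr_neq0 r0)))/negP; apply; apply/eqP.
    apply: (mulfI r0); rewrite E'.
    have -> : uval y = uval r * uval r / uval x by rewrite E mulrC mulKf.
    by field; rewrite r0 uE.
  apply/forallP => x; apply/forallP => y; apply/implyP => /eqP /(congr1 val) /= E.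
  apply/negP => /eqP E'.
  (* Here [x y = r^-2] and [r z = - (x + y)], so [w = r^2 z] would be [h + 1 / h] for
     [h = - r x]. *)
  move: wN; rewrite inE => /forallP/(_ (- (uval r * uval x)))/implyP.
  rewrite oppr_eq0 mulf_neq0 // => /(_ isT)/negP; apply; apply/eqP.
  have yE : uval y = (uval x * (uval r * uval r))^-1.
    by rewrite E; field; rewrite !uE oner_neq0.
  by rewrite wE expr2 -mulrA E' yE; field; rewrite oppr_eq0 mulf_neq0 ?r0 ?uE.
move/subset_leq_card; rewrite cardsX => cS.
have {}cS := leq_trans cS (leq_imset_card _ _).
have q8 : (#|F| - 3 <= 8 * #|Q|)%N.
  have := card_nonsum_inv; move: cM cQ.
  by move: #|M| #|Q| #|nonsum_inv| #|F| => *; lia.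
have : ((#|F| - 3) ^ 2 <= (8 * #|Q|) ^ 2)%N by rewrite leq_sqr.
move/leq_trans; apply; rewrite expnMn leq_mul2l /=; exact: cS.
Qed.

End UncoveredPairs.

(** * The fibres over Z_n *)

Section ConnectionSets.
Variables p n : nat.
Notation Zn := 'I_n.-1.+1.
Implicit Types (x s : {unit 'F_p}) (y t : 'F_p) (u v w : Zn).

Lemma mulFFZ x x' y y' u u' :
  ((x, y, u) * (x', y', u') : FFZ p n)%g = ((x * x')%g, y + y', u + u').
Proof. by []. Qed.

Lemma invFFZ x y u : ((x, y, u) : FFZ p n)^-1%g = ((x^-1)%g, - y, - u).
Proof. by []. Qed.

(** Inversion sends [b_v(x)] to [(x^-1, 0, -v)], so [B_v] consists of all [(x, 0, v)] and
    [(x, 0, -v)], and similarly for [C_w]. For these sets only the symmetrized index set matters, in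
    contrast to [A_u]. *)
Definition symmetrize (V : {set Zn}) : {set Zn} :=
  [set v | (v \in V) || (- v \in V)].

(* The third coordinates of the sets C_w, including C_0 for odd l. *)
Definition c_fibers l (W : {set Zn}) : {set Zn} :=
  if odd l then 0 |: symmetrize W else symmetrize W.

Variant base_spec (U V W : {set Zn}) : FFZ p n -> Prop :=
| BaseA x u of u \in U : base_spec U V W (x, val x, u)
| BaseAinv x u of u \in U : base_spec U V W ((x^-1)%g, - val x, - u)
| BaseB x v of v \in V : base_spec U V W (x, 0, v)
| BaseC y w of w \in W : base_spec U V W (1%g, y, w).

Lemma base_setP l (U V W : {set Zn}) (g : FFZ p n) :
  reflect (g <> 1%g /\ base_spec U (symmetrize V) (c_fibers l W) g)
    (g \in base_set p l U V W).
Proof.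
apply: (iffP idP).
  rewrite finset.in_setD1 => /andP[/eqP g1] H; split=> //; move: H.
  rewrite !finset.in_setU -!orbA => /or4P[].
  - case/bigcupP => u uU; rewrite finset.in_setU.
    case/orP => /imsetP[x _ ->]; first exact: BaseA.
    by rewrite invFFZ; apply: BaseAinv.
  - case/bigcupP => u uU; rewrite finset.in_setU.
    case/orP => /imsetP[x _ ->]; rewrite /b_ ?invFFZ ?oppr0; apply: BaseB.
      by rewrite inE uU.
    by rewrite inE opprK uU orbT.
  - case/bigcupP => u uU; rewrite finset.in_setU /c_fibers.
    case/orP => /imsetP[x _ ->]; rewrite /c_ ?invFFZ ?invg1; apply: BaseC.
      by case: ifP => _; rewrite !inE uU ?orbT.
    by case: ifP => _; rewrite !inE opprK uU ?orbT.
  - rewrite /c_fibers; case: ifP => _; last by rewrite inE.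
    rewrite finset.in_setU.
    case/orP => /imsetP[x _ ->]; rewrite /c_ ?invFFZ ?invg1 ?oppr0; apply: BaseC;
    by rewrite !inE eqxx.
case=> /eqP g1 gs; rewrite finset.in_setD1 g1 /=; move: gs => {g1}.
rewrite !finset.in_setU; case=> [x u uU|x u uU|x v|y w].
- suff -> : (x, val x, u) \in \bigcup_(u in U) A_ p u by [].
  by apply/bigcupP; exists u => //; rewrite finset.in_setU (imset_f (a_ u)).
- suff -> : ((x^-1)%g, - val x, - u) \in \bigcup_(u in U) A_ p u by [].
  apply/bigcupP; exists u => //; rewrite finset.in_setU orbC.
  by rewrite (imset_f (fun x => (a_ u x)^-1)%g).
- rewrite inE => vV.
  suff -> : (x, 0, v) \in \bigcup_(v in V) B_ p v by rewrite orbT.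
  case/orP: vV => vV; apply/bigcupP; [exists v => //|exists (- v) => //];
    rewrite finset.in_setU.
    by rewrite (imset_f (b_ v)).
  apply/orP; right; apply/imsetP; exists (x^-1)%g => //.
  by rewrite /b_ invFFZ invgK oppr0 opprK.
- move=> wW.
  have [wW'|] := boolP (w \in symmetrize W).
    suff -> : (1%g, y, w) \in \bigcup_(v in W) C_ p v by rewrite !orbT.
    move: wW'; rewrite inE => wW'.
    case/orP: wW' => wW'; apply/bigcupP; [exists w => //|exists (- w) => //];
      rewrite finset.in_setU.
      by rewrite (imset_f (c_ w)).
    apply/orP; right; apply/imsetP; exists (- y) => //.
    by rewrite /c_ invFFZ invg1 !opprK.
  move: wW; rewrite /c_fibers; case: ifP => // _; last by move=> ->.
  rewrite finset.in_setU1 => /orP[/eqP ->|->//] _.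
  by rewrite finset.in_setU (imset_f (c_ 0)) ?orbT.
Qed.

End ConnectionSets.

(** * Products of two generators over a fibre *)

Section Fibers.
Variables p n : nat.
Notation Zn := 'I_n.-1.+1.

Implicit Types (U V W : {set Zn}).

Definition sumset (U V : {set Zn}) : {set Zn} :=
  [set uv.1 + uv.2 | uv in finset.setX U V].
Definition diffset (U V : {set Zn}) : {set Zn} :=
  [set uv.2 - uv.1 | uv in finset.setX U V].

Lemma card_sumset U V : (#|sumset U V| <= #|U| * #|V|)%N.
Proof. by rewrite -cardsX leq_imset_card. Qed.

Lemma card_diffset U V : (#|diffset U V| <= #|U| * #|V|)%N.
Proof. by rewrite -cardsX leq_imset_card. Qed.

Lemma mem_sumset U V u v : u \in U -> v \in V -> u + v \in sumset U V.
Proof. by move=> uU vV; apply/imsetP; exists (u, v); rewrite ?inE ?uU. Qed.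

Lemma mem_diffset U V u v : u \in U -> v \in V -> v - u \in diffset U V.
Proof. by move=> uU vV; apply/imsetP; exists (u, v); rewrite ?inE ?uU. Qed.

Definition product_fibers (U V W : {set Zn}) : {set Zn} :=
  0 |: diffset U U :|: (sumset U V :|: diffset U V) :|:
  (sumset U W :|: diffset U W) :|: sumset V W.

Lemma card_product_fibers U V W :
  (#|product_fibers U V W| <=
    1 + (#|U| * #|U| - #|U|) + 2 * #|U| * #|V| + 2 * #|U| * #|W|
    + #|V| * #|W|)%N.
Proof.
(* The diagonal pairs only give the difference 0, which the summand 1 counts once. *)
pose D := [set uv.2 - uv.1 | uv in finset.setX U U :\: [set (u, u) | u in U]].
have cD : (#|D| <= #|U| * #|U| - #|U|)%N.
  apply: leq_trans (leq_imset_card _ _) _; rewrite cardsD cardsX.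
  have -> : finset.setX U U :&: [set (u, u) | u in U] = [set (u, u) | u in U].
    apply/finset.setIidPr/fintype.subsetP => _ /imsetP[u uU ->].
    by rewrite inE uU.
  by rewrite card_imset // => u v [].
have sub : product_fibers U V W \subset
    [set 0] :|: D :|: (sumset U V :|: diffset U V) :|:
      (sumset U W :|: diffset U W) :|: sumset V W.
  have DU : diffset U U \subset 0 |: D.
    apply/fintype.subsetP => _ /imsetP[[u v] uvU ->] /=; rewrite finset.in_setU1.
    have [->|uv] := eqVneq u v; first by rewrite subrr eqxx.
    apply/orP; right; apply/imsetP; exists (u, v) => //.
    rewrite finset.in_setD uvU andbT; apply/negP => /imsetP[w _ [Eu Ev]].
    by rewrite Eu Ev eqxx in uv.
  rewrite /product_fibers !finset.setUA !finset.setSU //.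
  by rewrite finset.subUset DU finset.subsetUl.
apply: leq_trans (subset_leq_card sub) _.
have cU (A B : {set Zn}) a b :
  (#|A| <= a -> #|B| <= b -> #|A :|: B| <= a + b)%N.
  by move=> ? ?; apply: leq_trans (leq_card_setU _ _) (leq_add _ _).
have cSD A B : (#|sumset A B :|: diffset A B| <= 2 * #|A| * #|B|)%N.
  by rewrite -mulnA mul2n -addnn cU ?card_sumset ?card_diffset.
by rewrite !cU ?cSD ?card_sumset ?cards1.
Qed.

(** Outside [product_fibers] only the products [A A], [A^-1 A^-1], [B B] and [C C] remain.
    [nonsum_pairs] excludes the first three, [B B] because its second coordinate is 0, and [C C] has
    first coordinate 1. *)
Lemma base_spec_mul (U V W : {set Zn}) (g h : FFZ p n) :
  base_spec U V W g -> base_spec U V W h ->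
  (g * h)%g.2 \notin product_fibers U V W ->
  (g * h)%g.1 \in nonsum_pairs 'F_p -> (g * h)%g.1.1 = 1%g.
Proof.
have inAA w : w \in diffset U U -> w \in product_fibers U V W.
  by rewrite !finset.in_setU => ->; rewrite orbT.
have inABp w : w \in sumset U V -> w \in product_fibers U V W.
  by rewrite !finset.in_setU => ->; rewrite !orbT.
have inABm w : w \in diffset U V -> w \in product_fibers U V W.
  by rewrite !finset.in_setU => ->; rewrite !orbT.
have inACp w : w \in sumset U W -> w \in product_fibers U V W.
  by rewrite !finset.in_setU => ->; rewrite !orbT.
have inACm w : w \in diffset U W -> w \in product_fibers U V W.
  by rewrite !finset.in_setU => ->; rewrite !orbT.
have inBC w : w \in sumset V W -> w \in product_fibers U V W.
  by rewrite !finset.in_setU => ->; rewrite !orbT.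
case=> [x u uU|x u uU|x v vV|y w wW];
  case=> [x' u' uU'|x' u' uU'|x' v' vV'|y' w' wW'];
  rewrite mulFFZ /= ?addr0 => /negP F S.
- move: S; rewrite inE /= => /and3P[_ /forallP/(_ x)/forallP/(_ x')/implyP].
  by move=> /(_ (eqxx _)); rewrite eqxx.
- by case: F; apply: inAA; apply: mem_diffset.
- by case: F; apply: inABp; apply: mem_sumset.
- by case: F; apply: inACp; apply: mem_sumset.
- by case: F; rewrite addrC; apply: inAA; apply: mem_diffset.
- move: S; rewrite inE /= => /and3P[_ _ /forallP/(_ x')/forallP/(_ x)/implyP].
  by rewrite invMg => /(_ (eqxx _)); rewrite addrC opprD eqxx.
- by case: F; rewrite addrC; apply: inABm; apply: mem_diffset.
- by case: F; rewrite addrC; apply: inACm; apply: mem_diffset.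
- by case: F; rewrite addrC; apply: inABp; apply: mem_sumset.
- by case: F; apply: inABm; apply: mem_diffset.
- by move: S; rewrite inE => /andP[/eqP].
- by case: F; apply: inBC; apply: mem_sumset.
- by case: F; rewrite addrC; apply: inACp; apply: mem_sumset.
- by case: F; apply: inACm; apply: mem_diffset.
- by case: F; rewrite addrC; apply: inBC; apply: mem_sumset.
- exact: mulg1.
Qed.

Lemma diameter2_mul (gT : finGroupType) (X : {set gT}) (g : gT) :
  has_diameter (cayley X) 2 ->
  [\/ g = 1%g, g \in X |
      exists2 x, x \in X & exists2 y, y \in X & g = (x * y)%g].
Proof.
case=> /(_ 1%g g)[k [[s [ps ls sk]] _] k2] _.
case: s ps ls sk => [|x [|y []]] /=.
- by move=> _ <- _; constructor 1.
- by rewrite andbT => /existsP[z /andP[zX /eqP ->]] <- _; rewrite mul1g; constructor 2.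
- rewrite andbT => /andP[/existsP[z /andP[zX /eqP ->]]].
  move=> /existsP[w /andP[wX /eqP ->]] <- _.
  by rewrite mul1g; constructor 3; exists z => //; exists w.
by move=> a r _ _ Ek; rewrite -Ek in k2.
Qed.

(** Each pair of [nonsum_pairs], placed over [w], gives the identity, an element of [X], a product
    with a factor in [E] on one side, or a point with first coordinate 1; the summands count
    these. *)
Lemma uncovered_fiber (l : nat) U V W (E X : {set FFZ p n}) (w : Zn) : prime p ->
  X = base_set p l U V W :|: E -> has_diameter (cayley X) 2 ->
  w \notin product_fibers U (symmetrize V) (c_fibers l W) ->
  (#|nonsum_pairs 'F_p| <= 1 + #|X| + 2 * (#|X| * #|E|) + p)%N.
Proof.
move=> pp EX dX wP.
pose XE := [set gh.1 * gh.2 | gh in finset.setX X E]%g.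
pose EX' := [set gh.1 * gh.2 | gh in finset.setX E X]%g.
pose L : {set FFZ p n} := [set (1%g, y, w) | y in [set: 'F_p]].
pose T : {set FFZ p n} := [set (st.1, st.2, w) | st in nonsum_pairs 'F_p].
have cT : #|T| = #|nonsum_pairs 'F_p|.
  by rewrite card_imset // => -[a b] [c d] [-> ->].
have cL : (#|L| <= p)%N.
  by apply: leq_trans (leq_imset_card _ _) _; rewrite cardsT card_Fp.
have cXE : (#|XE| <= #|X| * #|E|)%N by rewrite -cardsX leq_imset_card.
have cEX : (#|EX'| <= #|X| * #|E|)%N by rewrite mulnC -cardsX leq_imset_card.
have : T \subset [set 1%g] :|: X :|: (XE :|: EX') :|: L.
  apply/fintype.subsetP => _ /imsetP[[s t] stS ->] /=.
  rewrite !finset.in_setU finset.in_set1.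
  case: (diameter2_mul (s, t, w) dX) => [->|->|]; rewrite ?eqxx ?orbT //.
  case=> x xX [y yX Exy].
  have [xE|xE] := boolP (x \in E).
    suff -> : (s, t, w) \in EX' by rewrite !orbT.
    by apply/imsetP; exists (x, y) => //; rewrite inE xE.
  have [yE|yE] := boolP (y \in E).
    suff -> : (s, t, w) \in XE by rewrite !orbT.
    by apply/imsetP; exists (x, y) => //; rewrite inE xX.
  suff -> : (s, t, w) \in L by rewrite !orbT.
  have base z : z \in X -> z \notin E ->
      base_spec U (symmetrize V) (c_fibers l W) z.
    by rewrite EX finset.in_setU => /orP[/base_setP[]|->].
  have := base_spec_mul (base x xX xE) (base y yX yE).
  rewrite -Exy => /(_ wP stS) /= ->.
  by apply/imsetP; exists t; rewrite ?inE.
move/subset_leq_card; rewrite cT => /leq_trans; apply.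
apply: leq_trans (leq_card_setU _ _) _; apply: leq_add cL.
apply: leq_trans (leq_card_setU _ _) _; apply: leq_add.
  by apply: leq_trans (leq_card_setU _ _) _; rewrite cards1.
apply: leq_trans (leq_card_setU _ _) _.
by rewrite mul2n -addnn leq_add.
Qed.

End Fibers.

(** * The size of the base set *)

Lemma card_setU_sep (T : finType) (P : pred T) (A B : {set T}) :
  (forall x, x \in A -> P x) -> (forall x, x \in B -> ~~ P x) ->
  #|A :|: B| = (#|A| + #|B|)%N.
Proof.
move=> AP BP; rewrite cardsU (_ : A :&: B = finset.set0) ?cards0 ?subn0 //.
apply/finset.setP => x; rewrite !inE; apply/negP => /andP[/AP Px /BP].
by rewrite Px.
Qed.

(* The families A_u, A_u^-1, B_v and C_w are disjoint outside of the elements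
   whose first coordinate x satisfies x = 1 or, for the A_u, x^2 = -1. *)
Lemma card_base_set_ge (p n l : nat) (U V W : {set 'I_n.-1.+1}) : prime p ->
  ((2 * #|U| + #|symmetrize V| + #|c_fibers l W|) * p <=
   #|base_set p l U V W| + 8 * #|U| + 2 * #|symmetrize V| + 1)%N.
Proof.
move=> pp; set V' := symmetrize V; set W' := c_fibers l W.
pose Q := [set x : {unit 'F_p} | (x != 1%g) && (val x ^+ 2 != -1)].
have uF (x : {unit 'F_p}) : val x != 0 by rewrite -unitfE (valP x).
have cF : #|[set: {unit 'F_p}]| = p.-1 by rewrite card_finField_unit card_Fp.
(* At most three of the [p - 1] units are dropped: 1 and the roots of [x^2 = -1]. *)
have cQ : (p <= #|Q| + 4)%N.
  have cC : (#|~: Q| <= 3)%N.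
    pose R := [set x : {unit 'F_p} | val x ^+ 2 == -1].
    have -> : ~: Q = [set 1%g] :|: R.
      by apply/finset.setP => x; rewrite !inE negb_and !negbK.
    apply: leq_trans (leq_card_setU _ _) _; rewrite cards1 (leq_add2l 1 _ 2).
    have [->|[x]] := finset.set_0Vmem R; first by rewrite cards0.
    rewrite inE => /eqP xR.
    have : val @: R \subset [set val x; - val x].
      apply/fintype.subsetP => _ /imsetP[y + ->].
      by rewrite !inE -eqf_sqr xR.
    rewrite -(card_imset _ val_inj) => /subset_leq_card/leq_trans; apply.
    by rewrite cards2; case: eqP.
  by have := cardsC Q; have := prime_gt0 pp; rewrite -cardsT cF; lia.
pose fA (ux : 'I_n.-1.+1 * {unit 'F_p}) : FFZ p n := (ux.2, val ux.2, ux.1).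
pose fA' (ux : 'I_n.-1.+1 * {unit 'F_p}) : FFZ p n :=
  ((ux.2^-1)%g, - val ux.2, - ux.1).
pose fB (vx : 'I_n.-1.+1 * {unit 'F_p}) : FFZ p n := (vx.2, 0, vx.1).
pose fC (wy : 'I_n.-1.+1 * 'F_p) : FFZ p n := (1%g, wy.2, wy.1).
pose PA := fA @: finset.setX U Q.
pose PA' := fA' @: finset.setX U Q.
pose PB := fB @: finset.setX V' [set~ 1%g].
pose PC := (fC @: finset.setX W' [set: 'F_p]) :\ 1%g.
have cPA : #|PA| = (#|U| * #|Q|)%N.
  by rewrite card_imset ?cardsX // => -[a b] [c d] [-> _ ->].
have cPA' : #|PA'| = (#|U| * #|Q|)%N.
  rewrite card_imset ?cardsX // => -[a b] [c d] E.
  have /oppr_inj /= -> := congr1 snd E.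
  by have /invg_inj /= -> := congr1 (fun g : FFZ p n => g.1.1) E.
have cPB : (#|PB| = #|V'| * (p - 2))%N.
  rewrite card_imset ?cardsX; last by move=> [a b] [c d] [-> ->].
  by rewrite cardsC1 -cardsT cF -subn2; congr (_ * _)%N; lia.
have cPC : (#|W'| * p <= #|PC| + 1)%N.
  have : #|fC @: finset.setX W' [set: 'F_p]| = (#|W'| * p)%N.
    by rewrite card_imset ?cardsX ?cardsT ?card_Fp // => -[a b] [c d] [-> ->].
  move=> <-; rewrite /PC (cardsD1 1%g) addnC leq_add2l; exact: leq_b1.
have sub : PA :|: PA' :|: PB :|: PC \subset base_set p l U V W.
  apply/fintype.subsetP => g; rewrite !finset.in_setU => H.
  apply/base_setP; move: H; rewrite -!orbA => /or4P[/imsetP|/imsetP|/imsetP|].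
  - move=> [[u x] /setXP[uU]]; rewrite inE => /andP[/eqP x1 _] ->.
    split; last exact: BaseA.
    by move=> /(congr1 (fun g : FFZ p n => g.1.1)).
  - move=> [[u x] /setXP[uU]]; rewrite inE => /andP[/eqP x1 _] ->.
    split; last exact: BaseAinv.
    move=> /(congr1 (fun g : FFZ p n => g.1.1)) E; apply: x1.
    by apply: invg_inj; rewrite invg1.
  - move=> [[v x] /setXP[vV]]; rewrite !inE => /eqP x1 ->.
    split; last exact: BaseB.
    by move=> /(congr1 (fun g : FFZ p n => g.1.1)).
  rewrite finset.in_setD1 => /andP[/eqP g1 /imsetP[[w y] /setXP[wW _] E]].
  by split=> //; rewrite E; exact: BaseC.
have := subset_leq_card sub.
(* First coordinate 1 singles out [PC], then second coordinate 0 singles out [PB], and equality of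
   the two coordinates tells [PA] from [PA']. *)
rewrite (@card_setU_sep _ (fun g => g.1.1 != 1%g)); first last.
- move=> g; rewrite finset.in_setD1 => /andP[_ /imsetP[? _ ->]].
  by rewrite negbK.
- move=> g; rewrite !finset.in_setU -!orbA.
  by case/or3P=> /imsetP[[u x] /setXP[_ +] ->] /=;
    rewrite !inE ?eq_invg1 //; case/andP.
rewrite (@card_setU_sep _ (fun g => g.1.2 != 0)); first last.
- by move=> g /imsetP[? _ ->]; rewrite negbK.
- move=> g; rewrite !finset.in_setU.
  by case/orP => /imsetP[[u x] _ ->] /=; rewrite ?oppr_eq0; apply: uF.
rewrite (@card_setU_sep _ (fun g => val g.1.1 == g.1.2)); first last.
- move=> g /imsetP[[u x] /setXP[_ +] ->] /=; rewrite inE => /andP[_].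
  apply: contra => /eqP E; rewrite expr2 -{1}[val x]opprK -E mulNr eqr_opp /=.
  by rewrite mulVr //; apply: valP.
- by move=> g /imsetP[[u x] _ ->] /=.
rewrite cPA cPA' cPB => cX.
have : (#|U| * p <= #|U| * #|Q| + 4 * #|U|)%N.
  by rewrite [(4 * _)%N]mulnC -mulnDr leq_mul2l cQ orbT.
have : (#|V'| * p <= #|V'| * (p - 2) + 2 * #|V'|)%N.
  by rewrite [(2 * _)%N]mulnC -mulnDr leq_mul2l subnK ?leqnn ?orbT // prime_gt1.
have -> : ((2 * #|U| + #|V'| + #|W'|) * p =
           2 * (#|U| * p) + #|V'| * p + #|W'| * p)%N.
  by rewrite mulnDl [((_ + _) * p)%N]mulnDl mulnA.
move: cX cPC.
move: #|base_set p l U V W| (#|U| * p)%N (#|V'| * p)%N (#|U| * #|Q|)%N.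
move: (#|V'| * (p - 2))%N (#|W'| * p)%N #|PC| #|U| #|V'| => *; lia.
Qed.

(** * The bounds on n and on the order of the graph *)

Lemma admissible_opp1_mod n p :
  odd n -> prime p -> (n %| p.+1)%N -> admissible n p.
Proof.
move=> on pp np; have p0 := prime_gt0 pp.
split=> //.
- by rewrite -{1}(prednK p0) coprimeSn.
- by apply: coprime_dvdr np _; exact: coprimenS.
(* [d] divides [p - 1] and, through [n], also [p + 1], hence 2; but [n] is odd. *)
rewrite /coprime; set d := gcdn _ _.
have dn : (d %| n)%N by apply: dvdn_gcdr.
have d2 : (d %| 2)%N.
  have <- : (p.+1 - p.-1 = 2)%N by lia.
  by rewrite dvdn_sub ?dvdn_gcdl // (dvdn_trans dn).
have := dvdn_odd dn on; have := dvdn_leq (isT : (0 < 2)%N) d2.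
by case: d {dn} d2 => [|[|[|]]].
Qed.

(* With l = 2 a + b + c the right-hand side minus the left-hand side is
   (2 a - b - c)^2 + 2 (b - c)^2 + 8 a - 8. *)
Lemma fiber_count_le (l a b c : nat) : (3 <= l)%N -> (2 * a + b + c <= l)%N ->
  (8 * (1 + (a * a - a) + 2 * a * b + 2 * a * c + b * c) <= 3 * l ^ 2)%N.
Proof.
move=> l3 le; have {le} [d El] : exists d, l = (2 * a + b + c + d)%N.
  by exists (l - (2 * a + b + c))%N; rewrite subnKC.
have bc : 0 <= (b%:Z - c%:Z) ^+ 2 by rewrite sqr_ge0.
case: a El => [|a] El.
  (* For [a = 0] the term [8 a - 8] is negative; instead [8 b c <= 2 l^2] and, by [l >= 3],
     [8 <= l^2]. *)
  have l9 : (9 <= l ^ 2)%N by rewrite (leq_sqr 3 l).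
  rewrite El in l9 *; nia.
have abc : 0 <= (2 * (a.+1)%:Z - b%:Z - c%:Z) ^+ 2 by rewrite sqr_ge0.
have -> : (a.+1 * a.+1 - a.+1 = a * a + a)%N by lia.
have d0 : (0 <= d * (2 * a.+1 + b + c) + d * d)%N by [].
rewrite El; lia.
Qed.

Lemma realizable_le delta l n : (3 <= l)%N -> realizable delta l n ->
  (8 * n <= 3 * l ^ 2)%N.
Proof.
move=> l3 [on [m H]].
have [n1|n1] := leqP n 1.
  have : (3 * 3 ^ 2 <= 3 * l ^ 2)%N by rewrite leq_mul2l leq_exp2r.
  by apply: leq_trans; lia.
have n0 : n.-1.+1 = n by rewrite prednK // ltnW.
(* [K p] bounds [(1 + 2 m) |X|]. In the lower bound for [p], [D + 10 n] absorbs the error terms of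
   [card_base_set_ge], and [64 (2 + K)] makes [(p - 3)^2] exceed [64 (2 + K) p]. *)
pose D := absz delta; pose K := ((1 + 2 * m) * (l + D))%N.
have [p pp [Bp np]] := prime_eq_opp1_mod (D + 10 * n + 64 * (2 + K) + 10) n1 on.
have [X [_ _ _ cX [U [V [W [E [_ EX _ cE]]]]]] dX] :=
  H p (admissible_opp1_mod on pp np).
have cXle : (#|X| <= l * p + D)%N by lia.
have cB : (#|base_set p l U V W| <= #|X|)%N.
  by rewrite subset_leq_card // EX finset.subsetUl.
have cn (A : {set 'I_n.-1.+1}) : (#|A| <= n)%N.
  by rewrite -[leqRHS]n0 -[n.-1.+1 in leqRHS]card_ord max_card.
have := card_base_set_ge l U V W pp.
set a := #|U|; set b := #|_|; set c := #|_| => cge.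
have abc : (2 * a + b + c <= l)%N.
  have : ((2 * a + b + c) * p < l.+1 * p)%N.
    have := cn U; have := cn (symmetrize V); rewrite mulSn -/a -/b.
    move: cge cB cXle Bp; move: #|base_set p l U V W| #|X| => *; lia.
  by rewrite ltn_pmul2r ?prime_gt0 // ltnS.
have full : [set: 'I_n.-1.+1] \subset
    product_fibers U (symmetrize V) (c_fibers l W).
  (* Over a missed [w] at least [(p - 3)^2 / 64] pairs need covering, with only [(2 + K) p] elements
     available. *)
  apply/fintype.subsetP => w _; apply/negPn/negP => /(uncovered_fiber pp EX dX).
  have := card_nonsum_pairs 'F_p; rewrite card_Fp // cE.
  move: #|nonsum_pairs 'F_p| => s sp sX.
  have XK : (#|X| + 2 * (#|X| * m) <= K * p)%N.
    have -> : (#|X| + 2 * (#|X| * m) = (1 + 2 * m) * #|X|)%N by ring.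
    rewrite /K -mulnA leq_mul2l; apply/orP; right.
    by rewrite (leq_trans cXle) // mulnDl leq_add2l leq_pmulr ?prime_gt0.
  have : ((p - 3) ^ 2 <= 64 * (2 + K) * p)%N.
    apply: leq_trans sp _; rewrite -mulnA leq_mul2l /= (leq_trans sX) //.
    have := prime_gt0 pp; rewrite mulnDl.
    by move: XK; move: (K * p)%N (#|X| * m)%N #|X| => *; lia.
  have [q Ep] : exists q, p = (q + 6 + 64 * (2 + K))%N.
    by exists (p - 6 - 64 * (2 + K))%N; lia.
  have q0 : (0 < q)%N by lia.
  rewrite Ep; move: (64 * (2 + K))%N => k.
  have -> : (q + 6 + k - 3 = q + k + 3)%N by lia.
  have -> : ((q + k + 3) ^ 2 =
             k * (q + 6 + k) + (q * q + q * k + 6 * q + 9))%N by ring.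
  by rewrite leqNgt -[ltnLHS]addn0 ltn_add2l addn_gt0 orbT.
have := subset_leq_card full; rewrite cardsT card_ord.
move=> /(leq_trans (eq_leq (esym n0))) nF.
apply: leq_trans (fiber_count_le l3 abc); rewrite leq_mul2l /=.
by apply: leq_trans nF _; apply: card_product_fibers.
Qed.

Local Open Scope classical_set_scope.

Theorem theorem2 (R : realType) (delta : int) :
  (forall l : nat, (3 <= l)%N ->
     (exists n, realizable delta l n) -> exists n, is_nl delta l n) /\
  (exists2 g : nat -> R, g =O_\oo (fun d : nat => d%:R : R) &
     forall d : nat,
       (CC_G R delta d <= (3%:R / 8%:R * d%:R ^+ 2 + g d)%:E)%E).
Proof.
(* The realizable [n] are bounded in terms of [l], so there is a largest one as soon as there is
   one. *)
split=> [l l3 exn|].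
  pose P n := `[< realizable delta l n >].
  have exP : exists n, P n by case: exn => n ?; exists n; apply/asboolP.
  have bP n : P n -> (n <= 3 * l ^ 2)%N by move=> /asboolP /(realizable_le l3); lia.
  case: (ex_maxnP exP bP) => n /asboolP nP nmax; exists n; split=> // n' n'P.
  by apply/nmax/asboolP.
pose e : R := `|delta|%:~R.
(* These are the lower-order terms of [3 / 8 (d + e)^2]. *)
exists (fun d => 3 / 4 * e * d%:R + 3 / 8 * e ^+ 2).
  apply/eqO_exP; exists (3 / 4 * e + 3 / 8 * e ^+ 2 + 1).
    by rewrite ltr_wpDl // addr_ge0 // mulr_ge0 // sqr_ge0.
  near=> d.
  have d1 : (1 : R) <= d%:R by rewrite ler1n; near: d; exact: nbhs_infty_ge.
  have E0 : 0 <= 3 / 4 * e * d%:R by rewrite !mulr_ge0.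
  have E1 : 0 <= 3 / 8 * e ^+ 2 by rewrite mulr_ge0 ?sqr_ge0.
  rewrite !ger0_norm ?addr_ge0 //.
  have := ler_wpM2l E1 d1; rewrite mulr1 => E2.
  by move: (e ^+ 2) E2 => e2 E2; lra.
move=> d; apply: ge_ereal_sup => _ [l l3 <-].
apply: ge_ereal_sup => _ [n [p [[nr _] [pp _ _ _] dE ->]]].
rewrite lee_fin.
have n0 : (0 < n)%N by case: nr => on _; case: (n) on.
have -> : #|{: FFZ p n}| = (p.-1 * p * n)%N.
  rewrite !card_prod card_Fp // card_ord prednK // -[X in (X * _ * _)%N]cardsT.
  by rewrite card_finField_unit card_Fp.
(* [8 n <= 3 l^2] bounds the order by [3 / 8 (l p)^2], where [l p = d - delta]. *)
have np : (8 * (p.-1 * p * n) <= 3 * (l * p) ^ 2)%N.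
  have -> : (8 * (p.-1 * p * n) = 8 * n * (p.-1 * p))%N by ring.
  rewrite expnMn (mulnA 3); apply: leq_mul (realizable_le l3 nr) _.
  by rewrite -mulnn leq_mul2r leq_pred orbT.
have {}dE : (l * p)%:R = d%:R - delta%:~R :> R.
  by rewrite -[d%:R]/(d%:Z%:~R) dE rmorphD /= addrK.
have : (8 * (p.-1 * p * n))%:R <= (3 * (l * p) ^ 2)%:R :> R by rewrite ler_nat.
rewrite natrM [in leRHS]natrM natrX dE.
move: (p.-1 * p * n)%:R => N HN.
have e1 : delta%:~R <= e by rewrite ler_int ler_norm.
have e2 : - delta%:~R <= e by rewrite -rmorphN ler_int lerNl lerNnormlW.
have d0 : 0 <= d%:R :> R by [].
have : (d%:R - delta%:~R) ^+ 2 <= (d%:R + e) ^+ 2.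
  rewrite -real_normK ?num_real // ler_sqr ?nnegrE ?normr_ge0 ?addr_ge0 //.
  by rewrite ler_norml; apply/andP; split; lra.
lra.
Unshelve. all: by end_near.
Qed.
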